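(* Let $E$ be a measurable subset of $\Omega\times\mathbb{C}^n$ and let $\alpha>Q/2$, where $Q=2n+2$. Then there is a constant $C>0$, depending only on $n$ and $\alpha$, such that for all $f\in L^2(\mathbb{H}^n)$, $$\int_E|\mathcal{F}(f)(a,w)|^2\,d\nu_2(a)\,dw\ \le\ C\,|E|\ \|f\|_2^{2-Q/\alpha}\ \big\|\,|(z,t)|^\alpha f\,\big\|_2^{Q/\alpha},$$ where $|E|$ is the measure of $E$ with respect to $d\nu_2\,dw$, and the inequality is regarded as trivially true when its right-hand side is infinite.
   Context: Let $n\ge 1$. The Heisenberg group is $\mathbb{H}^n=\mathbb{C}^n\times\mathbb{R}$ with group law $(z,t)(w,s)=(z+w,\,t+s+\tfrac12\operatorname{Im}(z\overline{w}))$, where $z\overline{w}=\sum_j z_j\overline{w_j}$; its Haar measure is Lebesgue measure $dz\,dt$, its homogeneous dimension is $Q=2n+2$, and $|(z,t)|=(|z|^4+t^2)^{1/4}$ is the Korányi norm. For $\lambda\in\mathbb{R}^*=\mathbb{R}\setminus\{0\}$ and $k\in\mathbb{N}\cup\{0\}$ put $\varphi^{n-1}_{k,\lambda}(z)=L^{n-1}_k(\tfrac12|\lambda||z|^2)\,e^{-\frac14|\lambda||z|^2}$, where $L^{n-1}_k$ is the Laguerre polynomial of type $n-1$ and degree $k$, and $e^{n-1}_{k,\lambda}(z,t)=e^{i\lambda t}\varphi^{n-1}_{k,\lambda}(z)$. The Heisenberg fan $\Omega\subseteq\mathbb{R}^2$ is the union of the rays $R_k=\{(\lambda,(2k+n)|\lambda|):\lambda\in\mathbb{R}^*\}$,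 $k=0,1,2,\dots$, and $R_\infty=\{(0,\tau):\tau\ge0\}$. For $a=(\lambda,(2k+n)|\lambda|)\in R_k$ write $e_a=e^{n-1}_{k,\lambda}$. Let $c_{n,k}=\frac{k!(n-1)!}{(k+n-1)!}$. For $f\in (L^1\cap L^2)(\mathbb{H}^n)$ the normalized Strichartz Fourier transform is, for $a\in R_k$, $w\in\mathbb{C}^n$, $$\mathcal{F}(f)(a,w)=c_{n,k}\int_{\mathbb{H}^n}f(z,t)\,e_a\big((z,t)^{-1}(w,0)\big)\,dz\,dt .$$ The measure $\nu_2$ on $\Omega$ is $$\int_\Omega\phi\,d\nu_2=(2\pi)^{-2n-1}\int_{-\infty}^\infty\Big(\sum_{k=0}^\infty c_{n,k}^{-2}\,\phi(\lambda,(2k+n)|\lambda|)\Big)|\lambda|^{2n}\,d\lambda ,$$ so $R_\infty$ is $\nu_2$-null. By the Plancherel identity $\|f\|_{L^2(\mathbb{H}^n)}=\|\mathcal{F}(f)\|_{L^2(\Omega\times\mathbb{C}^n,\,d\nu_2\,dw)}$, $\mathcal{F}$ extends to an isometry of $L^2(\mathbb{H}^n)$ into $L^2(\Omega\times\mathbb{C}^n,d\nu_2\,dw)$. *)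

(* Defs.v *)
From HB Require Import structures.
From mathcomp Require Import all_boot all_order all_algebra.
From mathcomp Require Import complex ring.
From mathcomp Require Import all_classical all_reals all_analysis
  measurable_realfun.

Set Implicit Arguments.
Unset Strict Implicit.
Unset Printing Implicit Defensive.

Import Order.TTheory GRing.Theory Num.Theory.
Import numFieldNormedType.Exports.

Local Open Scope classical_set_scope.
Local Open Scope ring_scope.
Local Open Scope complex_scope.

(* [lebesgue_measure] lives on [measurableTypeR R], which is [R] with its Borel
   sets. *)
Notation Rm R := (measurableTypeR R).
Notation Cn R n := (n.-tuple R[i]).
Notation heis R n := (n.-tuple R[i] * measurableTypeR R)%type.

Section borel_complex.
Variable R : realType.

Definition complex_pair (z : R[i]) : Rm R * Rm R := (complex.Re z, complex.Im z).
Definition pair_complex (p : Rm R * Rm R) : R[i] := (p.1 : R) +i* (p.2 : R).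

HB.instance Definition _ := isPointed.Build R[i] 0.
HB.instance Definition _ :=
  Measurable.copy R[i] (g_sigma_algebra_preimageType complex_pair).

Lemma measurable_pair_complex : measurable_fun setT pair_complex.
Proof.
move=> _ A [B mB <-]; rewrite !setTI.
by rewrite (_ : _ @^-1` _ = B)//; apply/seteqP; split=> -[].
Qed.

Lemma measurable_complex_pair : measurable_fun setT complex_pair.
Proof. by move=> _ B mB; exists B. Qed.

Lemma measurable_Re : measurable_fun setT (@complex.Re R).
Proof. exact: (measurableT_comp measurable_fst measurable_complex_pair). Qed.

Lemma measurable_Im : measurable_fun setT (@complex.Im R).
Proof. exact: (measurableT_comp measurable_snd measurable_complex_pair). Qed.

End borel_complex.

Section sigma_finite_pushforward.
Context d1 d2 (T1 : measurableType d1) (T2 : measurableType d2) (R : realType).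
Variables (m : set T1 -> \bar R) (f : T1 -> T2) (g : T2 -> T1).
Hypotheses (mg : measurable_fun setT g) (fK : cancel f g).
Hypothesis sfm : sigma_finite setT m.

Lemma sigma_finite_pushforward : sigma_finite setT (pushforward m f).
Proof.
have [F TF mF] := sfm.
exists (fun i => g @^-1` F i) => [|i].
  by rewrite -preimage_bigcup -TF preimage_setT.
have [mFi Fioo] := mF i; split.
  by rewrite -[X in measurable X]setTI; exact: mg.
rewrite /pushforward (_ : f @^-1` _ = F i)//.
by apply/seteqP; split=> x /=; rewrite fK.
Qed.

End sigma_finite_pushforward.

Section sigma_finite_product.
Context d1 d2 (T1 : measurableType d1) (T2 : measurableType d2) (R : realType).
Variables (m1 : {sigma_finite_measure set T1 -> \bar R})
  (m2 : {sigma_finite_measure set T2 -> \bar R}).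

(* [m1 \x m2], but with an inferable sigma-finite structure: the instance found
   for [\x] only covers subprobabilities. *)
Definition sprod : set (T1 * T2) -> \bar R := (m1 \x m2)%E.

Let sprod0 : sprod set0 = 0%E. Proof. exact: (measure0 (m1 \x m2)%E). Qed.

Let sprod_ge0 A : (0 <= sprod A)%E.
Proof. exact: (measure_ge0 (m1 \x m2)%E). Qed.

Let sprod_sigma_additive : semi_sigma_additive sprod.
Proof. exact: (@measure_semi_sigma_additive _ _ _ (m1 \x m2)%E). Qed.

HB.instance Definition _ := isMeasure.Build _ _ _ sprod
  sprod0 sprod_ge0 sprod_sigma_additive.

Let sprod_sigma_finite : sigma_finite setT sprod.
Proof.
have /sigma_finiteP[F [TF ndF Foo]] := sigma_finiteT m1.
have /sigma_finiteP[G [TG ndG Goo]] := sigma_finiteT m2.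
exists (fun i => F i `*` G i).
  rewrite -setXTT TF TG predeqE => -[x y]; split.
    move=> [/= [i _ Fix] [j _ Gjy]]; exists (maxn i j) => //; split.
    - by move: x Fix; exact/subsetPset/ndF/leq_maxl.
    - by move: y Gjy; exact/subsetPset/ndG/leq_maxr.
  by move=> [i _ []/= ? ?]; split; exists i.
move=> k; have [? ?] := Foo k; have [? ?] := Goo k.
split; first exact: measurableX.
by rewrite /sprod product_measure1E// lte_mul_pinfty// ge0_fin_numE.
Qed.

HB.instance Definition _ := Measure_isSigmaFinite.Build _ _ _ sprod
  sprod_sigma_finite.

End sigma_finite_product.

Section lebesgue_complex.
Variable R : realType.
Local Notation leb := (@lebesgue_measure R).

Definition lebesgueC : set R[i] -> \bar R :=
  pushforward (sprod leb leb) (@pair_complex R).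

Let lebesgueC0 : lebesgueC set0 = 0%E.
Proof. by rewrite /lebesgueC /pushforward preimage_set0 measure0. Qed.

Let lebesgueC_ge0 A : (0 <= lebesgueC A)%E.
Proof. exact: (measure_ge0 (sprod leb leb)). Qed.

Let lebesgueC_sigma_additive : semi_sigma_additive lebesgueC.
Proof.
apply: measure_semi_sigma_additive; exact: measurable_pair_complex.
Qed.

HB.instance Definition _ := isMeasure.Build _ _ _ lebesgueC
  lebesgueC0 lebesgueC_ge0 lebesgueC_sigma_additive.

Let lebesgueC_sigma_finite : sigma_finite setT lebesgueC.
Proof.
apply: (@sigma_finite_pushforward _ _ _ _ _ _ _ (@complex_pair R)).
- exact: measurable_complex_pair.
- by case.
- exact: sigma_finiteT.
Qed.

HB.instance Definition _ := Measure_isSigmaFinite.Build _ _ _ lebesgueC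
  lebesgueC_sigma_finite.

End lebesgue_complex.

Section product_cons.
Context d (T : measurableType d) (R : realType) (n : nat).
Variables (m : {sigma_finite_measure set T -> \bar R})
  (v : {sigma_finite_measure set (n.-tuple T) -> \bar R}).

Let cons_pair (p : T * n.-tuple T) : n.+1.-tuple T := [tuple of p.1 :: p.2].
Let uncons (x : n.+1.-tuple T) : T * n.-tuple T :=
  (thead x, [tuple of behead x]).

Let measurable_cons_pair : measurable_fun setT cons_pair.
Proof. by apply: measurable_cons. Qed.

Let measurable_uncons : measurable_fun setT uncons.
Proof.
apply: measurable_fun_pair; first exact: measurable_tnth.
exact: measurable_behead.
Qed.

Let cons_pairK : cancel cons_pair uncons.
Proof. by move=> [x y]; congr pair; apply/val_inj. Qed.

Definition product_cons : set (n.+1.-tuple T) -> \bar R :=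
  pushforward (sprod m v) cons_pair.

Let product_cons0 : product_cons set0 = 0%E.
Proof. by rewrite /product_cons /pushforward preimage_set0 measure0. Qed.

Let product_cons_ge0 A : (0 <= product_cons A)%E.
Proof. exact: (measure_ge0 (sprod m v)). Qed.

Let product_cons_sigma_additive : semi_sigma_additive product_cons.
Proof.
apply: measure_semi_sigma_additive; exact: measurable_cons_pair.
Qed.

HB.instance Definition _ := isMeasure.Build _ _ _ product_cons
  product_cons0 product_cons_ge0 product_cons_sigma_additive.

Let product_cons_sigma_finite : sigma_finite setT product_cons.
Proof.
apply: (@sigma_finite_pushforward _ _ _ _ _ _ _ uncons) => //.
exact: sigma_finiteT.
Qed.

HB.instance Definition _ := Measure_isSigmaFinite.Build _ _ _ product_cons
  product_cons_sigma_finite.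

End product_cons.

Fixpoint lebesgueCn (R : realType) (n : nat) :
    {sigma_finite_measure set (Cn R n) -> \bar R} :=
  match n with
  | 0 => \d_[tuple]
  | n'.+1 => product_cons (@lebesgueC R) (lebesgueCn R n')
  end.

Section heisenberg.
Variables (R : realType) (n : nat).
Implicit Types (p q : heis R n) (z w : Cn R n).

Definition haar : set (heis R n) -> \bar R :=
  sprod (lebesgueCn R n) (@lebesgue_measure R).

HB.instance Definition _ := SigmaFiniteMeasure.on haar.

Definition homdim : nat := (2 * n + 2)%N.

Definition hermdot z w : R[i] := \sum_(j < n) tnth z j * (tnth w j)^*.

Definition normCn z : R := Num.sqrt (\sum_(j < n) Normc.normc (tnth z j) ^+ 2).

Definition hmul p q : heis R n :=
  ([tuple tnth p.1 j + tnth q.1 j | j < n],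
   (p.2 : R) + (q.2 : R) + 2^-1 * complex.Im (hermdot p.1 q.1)).

Definition hinv p : heis R n := ([tuple - tnth p.1 j | j < n], - (p.2 : R)).

Lemma hmulVp p : hmul (hinv p) p = ([tuple 0 | _ < n], 0).
Proof.
rewrite /hmul /hinv /hermdot /=; congr pair.
  by apply/eq_from_tnth => j; rewrite !tnth_mktuple addNr.
rewrite addNr add0r (_ : \sum_(_ < n) _ = (- \sum_(j < n) Normc.normc (tnth p.1 j) ^+ 2)%:C).
  by rewrite mulr0.
rewrite rmorphN rmorph_sum -sumrN; apply: eq_bigr => j _.
rewrite tnth_mktuple; case: (tnth p.1 j) => a b /=.
rewrite sqr_sqrtr ?addr_ge0 ?sqr_ge0//; simpc.
by congr (_ +i* _); ring.
Qed.

Definition koranyi p : R := (normCn p.1 ^+ 4 + (p.2 : R) ^+ 2) `^ (4^-1).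

End heisenberg.
Arguments haar : clear implicits.

Section complex_integration.
Context d (T : measurableType d) (R : realType).
Variable mu : {measure set T -> \bar R}.
Implicit Types f g : T -> R[i].

Definition Cintegral f : R[i] :=
  (\int[mu]_x complex.Re (f x)) +i* (\int[mu]_x complex.Im (f x)).

Definition CLnorm (p : R) f : \bar R :=
  'N[mu]_p%:E[(fun x => (Normc.normc (f x))%:E)].

Definition CLfun (p : R) : set (T -> R[i]) :=
  [set f | measurable_fun setT f /\ (CLnorm p f < +oo)%E].

End complex_integration.

Definition cexpi (R : realType) (x : R) : R[i] := cos x +i* sin x.

(* The polynomial L^m_k of type m and degree k. *)
Definition laguerre (R : realType) (m k : nat) : {poly R} :=
  \poly_(j < k.+1) ((-1) ^+ j * 'C(k + m, k - j)%:R / (j`!)%:R).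

Section spherical.
Variables (R : realType) (n : nat).

Definition laguerre_fun (k : nat) (l : R) (z : Cn R n) : R :=
  (laguerre R n.-1 k).[2^-1 * `|l| * normCn z ^+ 2] *
  expR (- (4^-1 * `|l| * normCn z ^+ 2)).

Definition spherical_fun (k : nat) (l : R) (p : heis R n) : R[i] :=
  cexpi (l * (p.2 : R)) * (laguerre_fun k l p.1)%:C.

Definition coef (k : nat) : R :=
  (k`! * n.-1`!)%:R / ((k + n.-1)`!)%:R.

End spherical.
Arguments coef : clear implicits.

Section fan.
Variables (R : realType) (n : nat).

Definition ray_point (k : nat) (l : R) : Rm R * Rm R :=
  (l, (2 * k + n)%:R * `|l|).

Definition ray (k : nat) : set (Rm R * Rm R) := ray_point k @` [set l | l != 0].

Definition ray_oo : set (Rm R * Rm R) :=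
  [set a | (a.1 : R) = 0 /\ 0 <= (a.2 : R)].

Definition fan : set (Rm R * Rm R) := (\bigcup_k ray k) `|` ray_oo.

Local Open Scope ereal_scope.

(* The integrand |l|^(2n) sum_k c_{n,k}^(-2) \1_A(l, (2k+n)|l|) in the formula
   that defines nu2, taken at the indicator of [A]. *)
Definition fan_density (A : set (Rm R * Rm R)) (l : R) : \bar R :=
  (\sum_(0 <= k <oo) ((coef R n k) ^- 2 * \1_A (ray_point k l))%:E)
    * (`|l| ^+ (2 * n))%:E.

Definition nu2 (A : set (Rm R * Rm R)) : \bar R :=
  ((2 * pi) ^- (2 * n + 1))%:E *
  \int[@lebesgue_measure R]_l fan_density A l.

Let coef_ge0 k : (0 <= (coef R n k) ^- 2)%R.
Proof. by rewrite invr_ge0 sqr_ge0. Qed.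

Let term_ge0 A l k : 0 <= ((coef R n k) ^- 2 * \1_A (ray_point k l))%:E.
Proof. by rewrite lee_fin mulr_ge0. Qed.

Let fan_density_ge0 A l : 0 <= fan_density A l.
Proof.
apply: mule_ge0; last by rewrite lee_fin exprn_ge0.
by apply: nneseries_ge0 => k _ _; exact: term_ge0.
Qed.

Lemma measurable_ray_point k :
  measurable_fun setT (ray_point k : Rm R -> Rm R * Rm R).
Proof.
by apply: measurable_fun_pair => //; apply: measurable_funM.
Qed.

Lemma measurable_fan_density A : measurable A ->
  measurable_fun setT (fan_density A : Rm R -> \bar R).
Proof.
move=> mA; apply: emeasurable_funM.
  apply: ge0_emeasurable_sum => k *; first exact: term_ge0.
  apply/measurable_EFinP/measurable_funM => //.
  apply: measurableT_comp => //; exact: measurable_ray_point.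
apply/measurable_EFinP; apply: measurable_funX.
exact: normr_measurable.
Qed.

Let nu2_0 : nu2 set0 = 0.
Proof.
rewrite /nu2 integral0_eq ?mule0// => l _.
by rewrite /fan_density eseries0 ?mul0e// => k _ _; rewrite indic0 mulr0.
Qed.

Let pi_ge0 : (0 <= (2 * pi) ^- (2 * n + 1) :> R)%R.
Proof. by rewrite invr_ge0 exprn_ge0// mulr_ge0// pi_ge0. Qed.

Let nu2_ge0 A : 0 <= nu2 A.
Proof.
by rewrite mule_ge0 ?lee_fin//; apply: integral_ge0 => l _; exact: fan_density_ge0.
Qed.

Let fan_density_sigma_additive (F : (set (Rm R * Rm R))^nat) l :
  (forall i, measurable (F i)) -> trivIset setT F ->
  measurable (\bigcup_i F i) ->
  fan_density (\bigcup_i F i) l = \sum_(0 <= i <oo) fan_density (F i) l.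
Proof.
move=> mF tF mUF.
rewrite /fan_density.
under [in RHS]eq_eseriesr do rewrite muleC.
rewrite nneseriesZl//; last first.
  by move=> i _; apply: nneseries_ge0 => k _ _; exact: term_ge0.
rewrite muleC; congr *%E.
rewrite nneseries_interchange; last by move=> *; exact: term_ge0.
apply: eq_eseriesr => k _.
under [in RHS]eq_eseriesr do rewrite EFinM.
rewrite nneseriesZl; last by [].
rewrite EFinM; congr *%E.
by apply/esym/cvg_lim => //;
  exact: (@measure_semi_sigma_additive _ _ _ (\d_(ray_point k l))).
Qed.

Let nu2_sigma_additive : semi_sigma_additive nu2.
Proof.
move=> F mF tF mUF.
suff -> : nu2 (\bigcup_i F i) = \sum_(0 <= i <oo) nu2 (F i).
  by apply: is_cvg_nneseries => *; exact: nu2_ge0.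
rewrite /nu2 nneseriesZl; last first.
  by move=> *; apply: integral_ge0 => l _; exact: fan_density_ge0.
congr *%E.
rewrite -integral_nneseries//.
- by apply: eq_integral => l _; exact: fan_density_sigma_additive.
- by move=> i; exact: measurable_fan_density.
Qed.

HB.instance Definition _ := isMeasure.Build _ _ _ nu2
  nu2_0 nu2_ge0 nu2_sigma_additive.

End fan.
Arguments ray : clear implicits.
Arguments fan : clear implicits.
Arguments nu2 : clear implicits.

Section strichartz.
Variables (R : realType) (n : nat).

Notation phase := ((Rm R * Rm R) * Cn R n)%type.

Definition nu2dw : {measure set phase -> \bar R} :=
  (nu2 R n \x lebesgueCn R n)%E.

(* The rays are pairwise disjoint for [0 < n], so [ray_index a] is the [k] with
   [a \in ray k]; it is junk off the rays. *)
Definition ray_index (a : Rm R * Rm R) : nat := get [set k | ray R n k a].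

Definition sft_L1 (f : heis R n -> R[i]) (aw : phase) : R[i] :=
  if aw.1 \in \bigcup_k ray R n k then
    let k := ray_index aw.1 in
    (coef R n k)%:C *
    Cintegral (haar R n)
      (fun p => f p * spherical_fun k aw.1.1 (hmul (hinv p) (aw.2, 0)))
  else 0.

(* [g] is a value at [f] of the extension of [sft_L1] by continuity from
   L^1 `&` L^2 to L^2; by the Plancherel identity such a [g] exists for every
   [f] in L^2, and it is unique up to a [nu2dw]-negligible set. *)
Definition is_L2_extension (f : heis R n -> R[i]) (g : phase -> R[i]) : Prop :=
  CLfun nu2dw 2 g /\
  exists u : (heis R n -> R[i])^nat,
    [/\ forall j, (CLfun (haar R n) 1 `&` CLfun (haar R n) 2) (u j),
        CLnorm (haar R n) 2 (u j \- f) @[j --> \oo] --> 0%E &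
        CLnorm nu2dw 2 (sft_L1 (u j) \- g) @[j --> \oo] --> 0%E].

(* On L^1 `&` L^2 this is the integral formula itself; on the rest of L^2 it is
   a chosen representative of the extension. *)
Definition sft (f : heis R n -> R[i]) : phase -> R[i] :=
  if f \in CLfun (haar R n) 1 then sft_L1 f
  else xget (cst 0) [set g | is_L2_extension f g].

End strichartz.

(* Main.v *)
(* Since |e_a| <= 1 / c_{n,k}, the transform of an integrable [f] is pointwise
   bounded by a multiple of ||f||_1, so the integral over [E] is at most a
   multiple of |E| ||f||_1^2; and for alpha > Q/2 one has
     ||f||_1^2 <= C ||f||_2^(2 - Q/alpha) || |.|^alpha f ||_2^(Q/alpha).
   When the right-hand side is finite, [f] is thus integrable and [sft f] is
   given by the integral formula: Plancherel is never needed.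

   The bound on e_a is |L^m_k(x)| e^(-x/2) <= C(k+m, k). The identity
   L^(m+1)_k = sum_(i <= k) L^m_i reduces it to m = 0, where (-1)^k k! L^0_k(x)
   is the value at j = k of x^k times the k-th Charlier polynomial C_k(j; x).
   The latter has squared norm k! x^k e^x with respect to the weights x^j / j!,
   which dominates the single term j = k.

   The L^1 bound follows from the weighted inequality 2 |f| <= s |f|^2 v + 1/(s v)
   with v a dyadic version of 1 + (|p|/r)^(2 alpha), after optimizing in r, s. *)

Require Import Defs.
From HB Require Import structures.
From mathcomp Require Import all_boot all_order all_algebra.
From mathcomp Require Import complex ring lra.
From mathcomp Require Import all_classical all_reals all_analysis
  measurable_realfun.

Set Implicit Arguments.
Unset Strict Implicit.
Unset Printing Implicit Defensive.

Import Order.TTheory GRing.Theory Num.Theory.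
Import numFieldNormedType.Exports.

Local Open Scope classical_set_scope.
Local Open Scope ring_scope.
Local Open Scope complex_scope.

(** * Laguerre functions are bounded by their value at the origin *)

Section charlier.
Variables (R : realType) (x : R).

(* [charlier k j] is [x ^+ k] times the Charlier polynomial [C_k(j; x)]; the
   recursion is the raising operator. *)
Fixpoint charlier (k j : nat) : R :=
  if k is k'.+1 then x * charlier k' j - j%:R * charlier k' j.-1 else 1.
Arguments charlier : simpl never.

Lemma charlierS k j :
  charlier k.+1 j = x * charlier k j - j%:R * charlier k j.-1.
Proof. by []. Qed.

(** The forward difference in [j] lowers the degree. It turns the raising recursion into the
    summation by parts below, and it controls the growth of [charlier k j] in [j]. *)
Lemma charlier_diff k j :
  charlier k.+1 j.+1 = charlier k.+1 j - k.+1%:R * charlier k j.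
Proof.
elim: k j => [|k IH] j.
  by rewrite !charlierS -natr1 ![charlier 0 _]/(1 : R); ring.
rewrite charlierS IH [charlier k.+2 j]charlierS [j.+1.-1]/=.
have -> : k.+2%:R = k%:R + 2 :> R by rewrite -addn2 natrD.
have -> : k.+1%:R = k%:R + 1 :> R by rewrite natr1.
case: j => [|j]; first by rewrite !charlierS mulr0n mulr1n; ring.
(* From here every term is expressed through [charlier k.+1 j.+1] and [charlier k j], after which
   the identity is polynomial. *)
have xD : x * charlier k j.+1 = charlier k.+1 j.+1 + j.+1%:R * charlier k j.
  by rewrite charlierS subrK.
have -> : j.+2%:R = j.+1%:R + 1 :> R by rewrite natr1.
have -> : charlier k.+1 j = charlier k.+1 j.+1 + k.+1%:R * charlier k j.
  by rewrite IH subrK.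
have -> : k.+1%:R = k%:R + 1 :> R by rewrite natr1.
rewrite mulrBr [x * (_ * _)]mulrCA xD; ring.
Qed.

Let w (j : nat) : R := x ^+ j / j`!%:R.

Let wS j : j.+1%:R * w j.+1 = x * w j.
Proof.
rewrite /w factS natrM invfM exprS; field.
by rewrite pnatr_eq0 -lt0n fact_gt0 nat1r pnatr_eq0.
Qed.

(* Summation by parts: the raising operator is adjoint to the difference
   operator, up to the boundary term at [N]. *)
Lemma charlier_sum k N :
  \sum_(j < N) w j * charlier k.+1 j ^+ 2 =
  k.+1%:R * x * (\sum_(j < N) w j * charlier k j ^+ 2) +
  N%:R * w N * charlier k.+1 N * charlier k N.-1.
Proof.
elim: N => [|N IH]; first by rewrite !big_ord0; ring.
rewrite !big_ord_recr/= IH wS charlier_diff charlierS; ring.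
Qed.

(** By [charlier_diff], the sequence [(-1) ^+ k.+1 * charlier k.+1 j] has increments [k.+1] times
    the same quantity at [k]. These are eventually at least 1, so the sequence climbs past 1 after
    finitely many steps. *)
Lemma charlier_sign k : exists J : nat, forall j : nat, (J <= j)%N ->
  1 <= (-1) ^+ k * charlier k j.
Proof.
elim: k => [|k [J HJ]]; first by exists 0%N => j _; rewrite mulr1.
pose d j := (-1) ^+ k.+1 * charlier k.+1 j.
have dS j : (J <= j)%N -> d j + 1 <= d j.+1.
  move=> Jj; rewrite /d charlier_diff.
  have -> : (-1) ^+ k.+1 * (charlier k.+1 j - k.+1%:R * charlier k j) =
    (-1) ^+ k.+1 * charlier k.+1 j + k.+1%:R * ((-1) ^+ k * charlier k j).
    by rewrite exprS; ring.
  rewrite lerD2l -[leLHS]mulr1 ler_pM//; last exact: HJ.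
  by rewrite ler1n.
have dD i : d J + i%:R <= d (J + i)%N.
  elim: i => [|i IH]; first by rewrite addn0 addr0.
  by rewrite addnS (le_trans _ (dS _ (leq_addr _ _)))// -natr1 addrA lerD2r.
exists (J + `|Num.ceil (1 - d J)|)%N => j Jj.
rewrite -[X in _ <= X]/(d j) -(subnKC (leq_trans (leq_addr _ _) Jj)).
apply: le_trans (dD _).
rewrite -lerBlDl.
have : (`|Num.ceil (1 - d J)| <= j - J)%N by rewrite -(leq_add2l J) subnKC// (leq_trans _ Jj)// leq_addr.
rewrite -(ler_nat R); apply: le_trans.
rewrite natr_absz (le_trans (Num.Theory.ceil_ge _))// ler_int; exact: ler_norm.
Qed.

(** The bound is the full squared norm. Only the sign of the boundary term in [charlier_sum] is
    used, so no limit in [N] is needed; the case [k = 0] compares partial sums of the exponential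
    series with [expR x]. *)
Lemma charlier_sum_le k : 0 <= x -> exists N0 : nat, forall N : nat, (N0 <= N)%N ->
  \sum_(j < N) w j * charlier k j ^+ 2 <= k`!%:R * x ^+ k * expR x.
Proof.
move=> x0.
have w0 j : 0 <= w j by rewrite divr_ge0// exprn_ge0.
elim: k => [|k [N0 H0]].
  exists 0%N => N _; rewrite !mul1r.
  under eq_bigr do rewrite expr1n mulr1.
  rewrite -(big_mkord xpredT w) /expR.
  apply: (@nondecreasing_cvgn_le _ (series (exp_coeff x))) => //.
    exact/nondecreasing_series.
  exact: is_cvg_series_exp_coeff.
have [J1 H1] := charlier_sign k; have [J2 H2] := charlier_sign k.+1.
(* [J1.+1] rather than [J1], since the boundary term samples [charlier k] at [N.-1]. *)
exists (maxn N0 (maxn J1.+1 J2)) => N; rewrite !geq_max => /and3P[NN0 NJ1 NJ2].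
(* By [charlier_sign] the boundary term is eventually nonpositive. *)
rewrite charlier_sum -[leRHS]addr0 lerD//.
  rewrite factS natrM exprS.
  have -> : k.+1%:R * k`!%:R * (x * x ^+ k) * expR x =
    k.+1%:R * x * (k`!%:R * x ^+ k * expR x) by ring.
  by rewrite ler_wpM2l ?mulr_ge0//; exact: H0.
have J1N : (J1 <= N.-1)%N by case: N NJ1 {NN0 NJ2}.
have := ler_pM ler01 ler01 (H1 _ J1N) (H2 _ NJ2).
rewrite mulr1 exprS.
have -> : (-1) ^+ k * charlier k N.-1 * (-1 * (-1) ^+ k * charlier k.+1 N) =
  - (((-1) ^+ k) ^+ 2 * (charlier k.+1 N * charlier k N.-1)) by ring.
rewrite sqrr_sign mul1r => le1.
rewrite -mulrA; apply: mulr_ge0_le0; first by rewrite mulr_ge0.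
by rewrite -oppr_ge0 (le_trans ler01).
Qed.

Lemma charlierE k j :
  charlier k j = \sum_(i < k.+1) (-1) ^+ i * ('C(k, i) * j ^_ i)%:R * x ^+ (k - i).
Proof.
elim: k j => [|k IH] j.
  by rewrite big_ord1 /= expr0 bin0 ffactn0 !mulr1.
rewrite charlierS !IH [RHS]big_ord_recl/= expr0 bin0 ffactn0 mul1n subn0.
(* Pascal's rule splits each coefficient in two, matching the two terms of the recursion; the second
   also uses [j * j.-1 ^_ i = j ^_ i.+1]. *)
under [in RHS]eq_bigr => i _.
  rewrite /bump /= add1n binS subSS mulnDl natrD mulrDr mulrDl.
  over.
rewrite big_split/= addrA; congr (_ + _).
  rewrite [in RHS]big_ord_recr/= bin_small// mul0n mulr0 mul0r addr0.
  rewrite big_ord_recl/= expr0 bin0 ffactn0 muln1 subn0 !mul1r mulrDr -exprS.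
  rewrite ?mulr1.
  congr (_ + _); rewrite mulr_sumr; apply: eq_bigr => i _.
  rewrite /bump/= add1n -[in RHS](subnSK (ltn_ord i)).
  by rewrite [x ^+ _.+1]exprS mulrCA.
rewrite mulr_sumr -sumrN; apply: eq_bigr => i _.
rewrite ffactnS exprS !natrM; ring.
Qed.

(** At [j = k] the falling factorial [k ^_ (k - i)] is [k! / i!], so reversing the order of
    summation produces the Laguerre coefficients. *)
Lemma charlier_laguerre k :
  charlier k k = (-1) ^+ k * k`!%:R * (laguerre R 0 k).[x].
Proof.
rewrite charlierE horner_poly mulr_sumr (reindex_inj rev_ord_inj)/=.
apply: eq_bigr => i _; have ik : (i <= k)%N by rewrite -ltnS.
rewrite subSS subKn// addn0 natrM -(ffact_fact (leq_subr i k)) subKn//.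
have -> : (-1) ^+ (k - i) = (-1) ^+ k * (-1) ^+ i :> R.
  by rewrite -[LHS]signr_odd oddB// signr_addb !signr_odd.
rewrite [in RHS]natrM; field.
by rewrite pnatr_eq0 -lt0n fact_gt0.
Qed.

Lemma laguerre0_sqr_le k : 0 <= x -> (laguerre R 0 k).[x] ^+ 2 <= expR x.
Proof.
(* The point [x = 0] is separate because the main argument cancels [x ^+ k]. *)
rewrite le_eqVlt => /predU1P[<-|x0].
  rewrite expR0 horner_coef0 coef_poly ltnS leq0n expr0 addn0 subn0 binn.
  by rewrite mul1r invr1 mulr1 expr1n.
have [N0 HN0] := charlier_sum_le k (ltW x0).
have := HN0 (N0 + k.+1)%N (leq_addr _ _).
have kN : (k < N0 + k.+1)%N by rewrite addnS ltnS leq_addl.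
rewrite (bigD1 (Ordinal kN))//=.
have kf0 : 0 < k`!%:R :> R by rewrite ltr0n fact_gt0.
move=> H.
have : w k * charlier k k ^+ 2 <= k`!%:R * x ^+ k * expR x.
  apply: le_trans H; rewrite lerDl; apply: sumr_ge0 => i _.
  by rewrite mulr_ge0 ?sqr_ge0// divr_ge0// exprn_ge0// ltW.
rewrite charlier_laguerre !exprMn sqrr_sign mul1r /w.
have -> : x ^+ k / k`!%:R * (k`!%:R ^+ 2 * (laguerre R 0 k).[x] ^+ 2) =
  k`!%:R * x ^+ k * (laguerre R 0 k).[x] ^+ 2.
  by field; rewrite gt_eqF.
by rewrite ler_pM2l// mulr_gt0// exprn_gt0.
Qed.

(** Pascal's rule on coefficients gives L^(m+1)_(k+1) = L^(m+1)_k + L^m_(k+1), which telescopes. *)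
Lemma laguerreS m k :
  (laguerre R m.+1 k).[x] = \sum_(i < k.+1) (laguerre R m i).[x].
Proof.
elim: k => [|k IH].
  by rewrite big_ord1 !horner_poly !big_ord1 !subnn !bin0.
rewrite big_ord_recr/= -IH !horner_poly [LHS]big_ord_recr [in X in _ + X]big_ord_recr/=.
rewrite !subnn !bin0 addrA; congr (_ + _).
rewrite -big_split/=; apply: eq_bigr => i _.
have ik : (i <= k)%N by rewrite -ltnS.
rewrite subSn// [(k.+1 + m.+1)%N]addSn binS natrD [(k.+1 + m)%N]addSnnS.
by rewrite -!mulrDl -!mulrDr addrC.
Qed.

Lemma laguerre_le m k : 0 <= x ->
  `|(laguerre R m k).[x]| * expR (- (x / 2)) <= 'C(k + m, k)%:R.
Proof.
move=> x0; elim: m k => [|m IH] k.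
  rewrite addn0 binn -[leLHS]ger0_norm ?mulr_ge0 ?expR_ge0// -(@expr_le1 _ 2)//.
  rewrite real_normK ?num_real// exprMn real_normK ?num_real// -expRM_natl.
  rewrite (_ : 2 * - _ = - x); last by field.
  by rewrite expRN ler_pdivrMr ?expR_gt0// mul1r laguerre0_sqr_le.
rewrite laguerreS.
apply: (@le_trans _ _ (\sum_(i < k.+1) 'C(i + m, i)%:R)).
  rewrite (le_trans (ler_wpM2r (expR_ge0 _) (ler_norm_sum _ _ _)))//.
  by rewrite mulr_suml; apply: ler_sum => i _; exact: IH.
(* Hockey-stick identity: the binomials sum to the value of L^(m+1)_k at the origin. *)
elim: k => [|k IHk]; first by rewrite big_ord1 !bin0.
rewrite big_ord_recr/= (le_trans (lerD IHk (lexx _)))// -natrD ler_nat.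
by rewrite [(k.+1 + m.+1)%N]addSn binS addnS addSn addnC.
Qed.

End charlier.

(** * Measurability and dyadic boxes on the Heisenberg group *)

Section measurability.
Variable R : realType.

Lemma normcE (z : R[i]) :
  Normc.normc z = Num.sqrt (complex.Re z ^+ 2 + complex.Im z ^+ 2).
Proof. by case: z. Qed.

Lemma normc_ge0 (z : R[i]) : 0 <= Normc.normc z.
Proof. by rewrite normcE sqrtr_ge0. Qed.

Lemma normc_real (x : R) : Normc.normc (x%:C) = `|x|.
Proof. by rewrite normcE/= expr0n addr0 sqrtr_sqr. Qed.

Lemma Re_le_normc (z : R[i]) : `|complex.Re z| <= Normc.normc z.
Proof. by rewrite normcE -sqrtr_sqr ler_wsqrtr// lerDl sqr_ge0. Qed.

Lemma Im_le_normc (z : R[i]) : `|complex.Im z| <= Normc.normc z.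
Proof. by rewrite normcE -sqrtr_sqr ler_wsqrtr// lerDr sqr_ge0. Qed.

Lemma normc_le (z : R[i]) : Normc.normc z <= `|complex.Re z| + `|complex.Im z|.
Proof.
rewrite normcE -[leRHS]ger0_norm ?addr_ge0// -sqrtr_sqr ler_wsqrtr//.
rewrite sqrrD !real_normK ?num_real// addrAC lerDl.
by rewrite mulrn_wge0// mulr_ge0.
Qed.

Lemma measurable_sqrt : measurable_fun setT (@Num.sqrt R : Rm R -> Rm R).
Proof. apply: continuous_measurable_fun; exact: sqrt_continuous. Qed.

Lemma measurable_normc : measurable_fun setT (@Normc.normc R : R[i] -> Rm R).
Proof.
rewrite (_ : (@Normc.normc R : R[i] -> Rm R) =
  (@Num.sqrt R : Rm R -> Rm R) \o
  (fun z => complex.Re z ^+ 2 + complex.Im z ^+ 2)); last first.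
  by apply/funext => z; rewrite /= normcE.
apply: measurableT_comp; first exact: measurable_sqrt.
apply: measurable_funD; apply: measurable_funX.
  exact: measurable_Re.
exact: measurable_Im.
Qed.

Variable n : nat.

Lemma normCn_ge0 (z : Cn R n) : 0 <= normCn z.
Proof. exact: sqrtr_ge0. Qed.

Lemma normc_le_normCn (z : Cn R n) j : Normc.normc (tnth z j) <= normCn z.
Proof.
rewrite -[leLHS]ger0_norm ?normc_ge0// -sqrtr_sqr ler_wsqrtr//.
by rewrite (bigD1 j)//= lerDl sumr_ge0// => i _; exact: sqr_ge0.
Qed.

Lemma measurable_normCn : measurable_fun setT (@normCn R n : Cn R n -> Rm R).
Proof.
apply: measurableT_comp; first exact: measurable_sqrt.
apply: measurable_sum => j; apply: measurable_funX.
apply: (measurableT_comp measurable_normc); exact: measurable_tnth.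
Qed.

Lemma measurable_koranyi :
  measurable_fun setT (@koranyi R n : heis R n -> Rm R).
Proof.
apply: (measurableT_comp (measurable_powR _)).
apply: measurable_funD; apply: measurable_funX.
  apply: (measurableT_comp measurable_normCn); exact: measurable_fst.
exact: measurable_snd.
Qed.

End measurability.

Section box.
Variable R : realType.

Definition square (rho : R) : set R[i] :=
  [set z | `|complex.Re z| <= rho /\ `|complex.Im z| <= rho].

Definition cbox n (rho : R) : set (Cn R n) :=
  [set z | forall j, square rho (tnth z j)].

(** The side [rho ^+ 2] in the central variable follows the Heisenberg dilations, so the volume
    scales like [rho ^+ homdim n]. Boxes replace Korányi balls because their volume is an explicit
    product. *)
Definition hbox n (rho : R) : set (heis R n) :=
  @cbox n rho `*` `[- rho ^+ 2, rho ^+ 2].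

Lemma squareE rho :
  square rho = @complex_pair R @^-1` (`[- rho, rho] `*` `[- rho, rho]).
Proof.
by apply/seteqP; split=> z /=; rewrite !in_itv/= -!ler_norml.
Qed.

Lemma measurable_square rho : measurable (square rho).
Proof.
rewrite squareE -[X in measurable X]setTI; apply: measurable_complex_pair => //.
exact: measurableX.
Qed.

Lemma lebesgue_measure_itv_sym (a : R) : 0 <= a ->
  @lebesgue_measure R `[- a, a] = (2 * a)%:E.
Proof.
move=> a0; rewrite lebesgue_measure_itv/= lte_fin.
case: ltP => [_|h]; first by rewrite -EFinB opprK mulr_natl.
by rewrite (_ : a = 0) ?mulr0//; lra.
Qed.

Lemma lebesgueC_square rho : 0 <= rho ->
  lebesgueC (square rho) = ((2 * rho) ^+ 2)%:E.
Proof.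
move=> rho0; rewrite /lebesgueC /pushforward squareE -comp_preimage/=.
rewrite (_ : _ @^-1` _ = `[- rho, rho] `*` `[- rho, rho])//.
rewrite /sprod product_measure1E//.
rewrite [X in (X * _)%E](lebesgue_measure_itv_sym rho0).
by rewrite [X in (_ * X)%E](lebesgue_measure_itv_sym rho0).
Qed.

Lemma measurable_cbox n rho : measurable (@cbox n rho).
Proof.
rewrite (_ : cbox _ = \bigcap_(j in [set: 'I_n]) ((tnth (T:=R[i]))^~ j @^-1` square rho)).
  apply: fin_bigcap_measurable => [|j _]; first exact: finite_finset.
  rewrite -[X in measurable X]setTI; apply: measurable_tnth => //.
  exact: measurable_square.
by apply/seteqP; split=> z /= h j; [move=> _|]; exact: h.
Qed.

Lemma lebesgueCn_cbox n rho : 0 <= rho ->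
  lebesgueCn R n (@cbox n rho) = ((2 * rho) ^+ (2 * n))%:E.
Proof.
move=> rho0; elim: n => [|n IH].
  rewrite muln0 expr0 /= diracE mem_set//.
  by case.
rewrite /= /product_cons /pushforward.
rewrite (_ : _ @^-1` _ = square rho `*` @cbox n rho); last first.
  apply/seteqP; split=> [[z w]|[z w] [zQ wQ]] /=.
    move=> H; split=> [|j]; first by have := H ord0.
    by have := H (lift ord0 j); rewrite !(tnth_nth 0).
  move=> j; case: (unliftP ord0 j) => [i ->|->]; last by rewrite tnth0.
  by have := wQ i; rewrite !(tnth_nth 0).
rewrite /sprod product_measure1E.
- rewrite [X in (X * _)%E](lebesgueC_square rho0) [X in (_ * X)%E]IH.
  by rewrite -EFinM -exprD mulnS.
- exact: measurable_square.
- exact: measurable_cbox.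
Qed.

Lemma measurable_hbox n rho : measurable (@hbox n rho).
Proof. by apply: measurableX => //; exact: measurable_cbox. Qed.

Lemma haar_hbox n rho : 0 <= rho ->
  haar R n (@hbox n rho) = (2 ^+ (2 * n).+1 * rho ^+ homdim n)%:E.
Proof.
move=> rho0; rewrite /haar /sprod product_measure1E//; last exact: measurable_cbox.
rewrite [X in (X * _)%E](lebesgueCn_cbox _ rho0).
rewrite [X in (_ * X)%E](lebesgue_measure_itv_sym (sqr_ge0 rho)).
rewrite -EFinM; congr (_%:E).
by rewrite /homdim exprD exprMn [2 ^+ _.+1]exprS; ring.
Qed.

Lemma koranyi_ge0 n (p : heis R n) : 0 <= koranyi p.
Proof. exact: powR_ge0. Qed.

Lemma koranyi_pow4 n (p : heis R n) :
  koranyi p ^+ 4 = normCn p.1 ^+ 4 + (p.2 : R) ^+ 2.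
Proof.
rewrite -powR_mulrn ?koranyi_ge0// /koranyi -powRrM mulVf ?powRr1//.
by rewrite addr_ge0 ?sqr_ge0// exprn_ge0// normCn_ge0.
Qed.

(** The fourth power of [koranyi] dominates both [normCn p.1 ^+ 4] and [p.2 ^+ 2], so the box
    contains the open Korányi ball of the same radius. *)
Lemma le_koranyi_not_hbox n rho (p : heis R n) : 0 <= rho ->
  ~ hbox rho p -> rho <= koranyi p.
Proof.
move=> rho0; apply: contra_notP => /negP; rewrite -ltNge => plt.
have p4 : koranyi p ^+ 4 <= rho ^+ 4 by rewrite lerXn2r// ?nnegrE ?koranyi_ge0// ltW.
rewrite koranyi_pow4 in p4.
have zle : normCn p.1 <= rho.
  rewrite -(@ler_pXn2r _ 4)// ?nnegrE ?normCn_ge0// (le_trans _ p4)// lerDl.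
  exact: sqr_ge0.
split=> [j|/=].
  by split; rewrite (le_trans _ (le_trans (normc_le_normCn p.1 j) zle))//;
    [exact: Re_le_normc|exact: Im_le_normc].
rewrite in_itv/= -ler_norml -(@ler_pXn2r _ 2)// ?nnegrE ?sqr_ge0//.
rewrite real_normK ?num_real// -exprM (le_trans _ p4)// lerDr.
by rewrite exprn_ge0// normCn_ge0.
Qed.

End box.

(** * The L1 norm interpolates between the weighted L2 norms *)

Section interpolation.
Variables (R : realType) (n : nat) (alpha : R).
Hypothesis alphaQ : (homdim n)%:R / 2 < alpha.

Let alpha_gt0 : 0 < alpha.
Proof. by apply: le_lt_trans alphaQ; rewrite divr_ge0. Qed.

Let T : R := 2 `^ alpha.

Let T_gt0 : 0 < T. Proof. exact: powR_gt0. Qed.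

(** This is 2^(Q - 2 alpha), the factor by which the weighted box volume changes when the radius
    doubles. It is below 1 exactly because alpha > Q/2. *)
Let ratio : R := T ^- 2 * 2 ^+ homdim n.

Let ratio_ge0 : 0 <= ratio.
Proof. by rewrite mulr_ge0 ?exprn_ge0// invr_ge0 exprn_ge0// ltW. Qed.

Let ratio_lt1 : ratio < 1.
Proof.
rewrite /ratio mulrC ltr_pdivrMr ?exprn_gt0// mul1r.
rewrite -[2 ^+ _]powR_mulrn// -[T ^+ 2]powR_mulrn ?(ltW T_gt0)// /T -powRrM.
by rewrite /powR !pnatr_eq0/= ltr_expR ltr_pM2r ?ln_gt0 ?ltr1n// -ltr_pdivrMr.
Qed.

(* Comparable to [(1 + (koranyi p / r) ^ (2 alpha))^-1]. *)
Definition dyadic_weight (r : R) (p : heis R n) : \bar R :=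
  (\sum_(0 <= j <oo) ((2 `^ alpha) ^- (2 * j) * \1_(hbox (2 ^+ j * r)) p)%:E)%E.

Let term_ge0 r j p : (0 <= (T ^- (2 * j) * \1_(@hbox R n (2 ^+ j * r)) p)%:E)%E.
Proof. by rewrite lee_fin mulr_ge0// invr_ge0 exprn_ge0// ltW. Qed.

Let measurable_term r j : measurable_fun setT
  (fun p => (T ^- (2 * j) * \1_(@hbox R n (2 ^+ j * r)) p)%:E).
Proof.
apply/measurable_EFinP/measurable_funM => //.
apply: measurable_indic; exact: measurable_hbox.
Qed.

Lemma dyadic_weight_ge0 r p : (0 <= dyadic_weight r p)%E.
Proof. by apply: nneseries_ge0 => j _ _; exact: term_ge0. Qed.

Lemma measurable_dyadic_weight r : measurable_fun setT (dyadic_weight r).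
Proof.
apply: ge0_emeasurable_sum => [j p _ _|j _]; first exact: term_ge0.
exact: measurable_term.
Qed.

(** Volume of the unit box times the sum of the geometric series of ratio [ratio]. *)
Let K : R := 2 ^+ (2 * n).+1 / (1 - ratio).

Let K_gt0 : 0 < K.
Proof. by rewrite divr_gt0 ?exprn_gt0// subr_gt0. Qed.

Let integral_term r j : 0 <= r ->
  (\int[haar R n]_p (T ^- (2 * j) * \1_(@hbox R n (2 ^+ j * r)) p)%:E =
   (ratio ^+ j * (2 ^+ (2 * n).+1 * r ^+ homdim n))%:E)%E.
Proof.
move=> r0; under eq_integral do rewrite EFinM.
rewrite ge0_integralZl_EFin ?invr_ge0 ?exprn_ge0 ?(ltW T_gt0)//; last first.
  apply/measurable_EFinP; apply: measurable_indic; exact: measurable_hbox.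
rewrite integral_indic//; last exact: measurable_hbox.
rewrite setIT [X in (_ * X)%E]haar_hbox ?mulr_ge0 ?exprn_ge0// -EFinM.
congr (_%:E).
rewrite exprM -exprVn [(2 ^+ j * r) ^+ _]exprMn -exprM [(j * _)%N]mulnC exprM.
by rewrite /ratio [in RHS]exprMn; ring.
Qed.

Lemma integral_dyadic_weight r : 0 <= r ->
  (\int[haar R n]_p dyadic_weight r p <= (K * r ^+ homdim n)%:E)%E.
Proof.
move=> r0; rewrite integral_nneseries//.
under eq_eseriesr => j _ do rewrite (integral_term j r0).
apply: lime_le.
  apply: is_cvg_nneseries => j _ _.
  by rewrite lee_fin !mulr_ge0 ?exprn_ge0.
near=> N.
rewrite sumEFin lee_fin -mulr_suml /K mulrA ler_wpM2r ?exprn_ge0//.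
rewrite [leRHS]mulrC ler_wpM2r ?exprn_ge0//.
rewrite -[leRHS]mul1r ler_pdivlMr ?subr_gt0// big_mkord.
have := subrX1 ratio N; have := exprn_ge0 N ratio_ge0; lra.
Unshelve. all: by end_near.
Qed.

Lemma dyadic_pointwise r s (p : heis R n) (y : R) : 0 < r -> 0 < s -> 0 <= y ->
  ((2 * y)%:E <= (s * y ^+ 2)%:E +
    (s * T ^+ 2 * (r `^ alpha) ^- 2 * (koranyi p `^ alpha * y) ^+ 2)%:E +
    (s^-1)%:E * dyadic_weight r p)%E.
Proof.
move=> r0 s0 y0.
have : exists j : nat, `[< hbox (2 ^+ j * r) p >].
  exists (Num.Def.archi_bound (koranyi p / r)); apply/asboolP.
  set j := Num.Def.archi_bound _; apply: contrapT => h.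
  have r2 : 0 <= 2 ^+ j * r by rewrite mulr_ge0 ?exprn_ge0// ltW.
  have := le_koranyi_not_hbox r2 h.
  apply/negP; rewrite -ltNge -ltr_pdivrMr//.
  apply: lt_trans (archi_boundP _) _; first by rewrite divr_ge0 ?koranyi_ge0// ltW.
  by rewrite -natrX ltr_nat ltn_expl.
move=> /ex_minnP[j /asboolP jp jmin].
(* Only the [j]-th term of the series is kept. *)
have Gj : ((T ^- (2 * j))%:E <= dyadic_weight r p)%E.
  apply: le_trans (nneseries_lim_ge j.+1 _); last by move=> i _ _; exact: term_ge0.
  rewrite big_nat_recr//= indicE mem_set// mulr1.
  by rewrite leeDr// sume_ge0// => i _; exact: term_ge0.
have Tj : 0 < T ^+ j by rewrite exprn_gt0.
have amgm : 2 * y <= s * (T ^+ j * y) ^+ 2 + s^-1 * T ^- (2 * j).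
  rewrite mulnC exprM -subr_ge0.
  rewrite (_ : _ - _ = s * (T ^+ j * y - s^-1 / T ^+ j) ^+ 2).
    by rewrite mulr_ge0 ?sqr_ge0// ltW.
  by field; rewrite !gt_eqF.
have yT : s * (T ^+ j * y) ^+ 2 <= s * y ^+ 2 +
   s * T ^+ 2 * (r `^ alpha) ^- 2 * (koranyi p `^ alpha * y) ^+ 2.
  have ra : 0 < r `^ alpha by exact: powR_gt0.
  case: j jp jmin {Gj Tj amgm} => [|j] jp jmin.
    rewrite expr0 mul1r lerDl mulr_ge0 ?sqr_ge0// mulr_ge0 ?invr_ge0 ?sqr_ge0//.
    by rewrite mulr_ge0 ?sqr_ge0// ltW.
  rewrite -[leLHS]add0r lerD ?mulr_ge0 ?sqr_ge0 ?(ltW s0)//.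
  rewrite (_ : s * _ * _ * _ =
      s * (T * (koranyi p `^ alpha / r `^ alpha * y)) ^+ 2); last first.
    by field; rewrite gt_eqF.
  rewrite ler_pM2l//; apply: lerXn2r; rewrite ?nnegrE.
  - by rewrite mulr_ge0 ?exprn_ge0// ltW.
  - by rewrite mulr_ge0 ?(ltW T_gt0)// mulr_ge0 ?divr_ge0 ?powR_ge0.
  rewrite exprS -mulrA ler_pM2l// ler_wpM2r// ler_pdivlMr//.
  have jr : 2 ^+ j * r <= koranyi p.
    apply: le_koranyi_not_hbox; first by rewrite mulr_ge0 ?exprn_ge0// ltW.
    by move=> /asboolP /jmin; rewrite ltnn.
  rewrite /T -powR_mulrn ?powR_ge0// powRAC powR_mulrn// -powRM ?exprn_ge0 ?(ltW r0)//.
  apply: ge0_ler_powR jr; rewrite ?nnegrE ?koranyi_ge0 ?(ltW alpha_gt0)//.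
  by rewrite mulr_ge0 ?exprn_ge0// ltW.
move: amgm; rewrite -lee_fin => /le_trans; apply.
rewrite EFinD; apply: leeD; first by rewrite -EFinD lee_fin.
by rewrite EFinM lee_pmul2l// lte_fin invr_gt0.
Qed.

Lemma dyadic_integral (f : heis R n -> R) r s : 0 < r -> 0 < s ->
  measurable_fun setT f -> (forall p, 0 <= f p) ->
  (2%:E * \int[haar R n]_p (f p)%:E <=
   s%:E * (\int[haar R n]_p (f p ^+ 2)%:E) +
   (s * T ^+ 2 * (r `^ alpha) ^- 2)%:E *
     (\int[haar R n]_p ((koranyi p `^ alpha * f p) ^+ 2)%:E) +
   (s^-1 * (K * r ^+ homdim n))%:E)%E.
Proof.
move=> r0 s0 mf f0.
have mk : measurable_fun setT (fun p => (koranyi p `^ alpha * f p) ^+ 2).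
  apply: measurable_funX; apply: measurable_funM => //.
  apply: (measurableT_comp (measurable_powR _)); exact: measurable_koranyi.
have mf2 : measurable_fun setT (fun p => f p ^+ 2) by exact: measurable_funX.
have sT : 0 <= s * T ^+ 2 * (r `^ alpha) ^- 2.
  by rewrite mulr_ge0 ?invr_ge0 ?exprn_ge0 ?powR_ge0// mulr_ge0 ?exprn_ge0// ltW.
have intZ c (g : heis R n -> R) : 0 <= c -> measurable_fun setT g ->
    (forall p, 0 <= g p) ->
    (c%:E * \int[haar R n]_p (g p)%:E = \int[haar R n]_p (c * g p)%:E)%E.
  move=> c0 mg g0; rewrite -ge0_integralZl_EFin//; last exact/measurable_EFinP.
  by move=> p _; rewrite lee_fin.
rewrite !intZ ?(ltW s0)//; try by move=> p; exact: sqr_ge0.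
apply: (@le_trans _ _ (\int[haar R n]_p (
    ((s * f p ^+ 2)%:E +
    (s * T ^+ 2 * (r `^ alpha) ^- 2 * (koranyi p `^ alpha * f p) ^+ 2)%:E) +
    (s^-1)%:E * dyadic_weight r p))%E).
  apply: ge0_le_integral => //.
  - by move=> p _; rewrite lee_fin mulr_ge0.
  - by apply/measurable_EFinP; apply: measurable_funM.
  - apply: emeasurable_funD; last first.
      by apply: measurable_funeM; exact: measurable_dyadic_weight.
    by apply: emeasurable_funD; apply/measurable_EFinP; apply: measurable_funM.
  - by move=> p _; exact: dyadic_pointwise.
rewrite ge0_integralD//; last 4 first.
- by move=> p _; rewrite -EFinD lee_fin addr_ge0// mulr_ge0 ?sqr_ge0// ltW.
- by apply: emeasurable_funD; apply/measurable_EFinP; apply: measurable_funM.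
- by move=> p _; rewrite mule_ge0 ?lee_fin ?invr_ge0 ?(ltW s0)// dyadic_weight_ge0.
- by apply: measurable_funeM; exact: measurable_dyadic_weight.
rewrite ge0_integralD//; last 4 first.
- by move=> p _; rewrite lee_fin mulr_ge0 ?sqr_ge0// ltW.
- by apply/measurable_EFinP; apply: measurable_funM.
- by move=> p _; rewrite lee_fin mulr_ge0 ?sqr_ge0.
- by apply/measurable_EFinP; apply: measurable_funM.
apply: leeD; first by [].
rewrite ge0_integralZl_EFin ?invr_ge0 ?(ltW s0)//; last 2 first.
- by move=> p _; exact: dyadic_weight_ge0.
- exact: measurable_dyadic_weight.
rewrite EFinM lee_wpmul2l ?lee_fin ?invr_ge0 ?(ltW s0)//.
by apply: integral_dyadic_weight; exact: ltW.
Qed.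

Let gamma : R := n.+1%:R / alpha.

Let gamma_gt0 : 0 < gamma. Proof. by rewrite divr_gt0. Qed.

Let homdimE : (homdim n)%:R = 2 * n.+1%:R :> R.
Proof. by rewrite /homdim -natrM mulnS addnC. Qed.

Let Qalpha : (homdim n)%:R / alpha = 2 * gamma.
Proof. by rewrite homdimE mulrA. Qed.

Let gamma_lt1 : gamma < 1.
Proof.
rewrite /gamma ltr_pdivrMr// mul1r (le_lt_trans _ alphaQ)//.
by rewrite homdimE mulrAC divff// mul1r.
Qed.

Lemma optimize_scales (a b i : R) : 0 < a -> 0 <= b -> 0 <= i ->
  (forall r s, 0 < r -> 0 < s -> 2 * i <= s * a ^+ 2 +
    s * T ^+ 2 * (r `^ alpha) ^- 2 * b ^+ 2 + s^-1 * (K * r ^+ homdim n)) ->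
  i ^+ 2 <= (1 + T ^+ 2 + K) ^+ 2 * a `^ (2 - 2 * gamma) * b `^ (2 * gamma).
Proof.
move=> a0 b0 i0 H; set L := 1 + T ^+ 2 + K.
have L0 : 0 < L by rewrite !addr_gt0// exprn_gt0.
have claim rho : 0 < rho -> b <= a * rho -> 2 * i <= L * a * rho `^ gamma.
  move=> rho0 brho; set r := rho `^ alpha^-1.
  have r0 : 0 < r by exact: powR_gt0.
  have ra : r `^ alpha = rho by rewrite /r -powRrM mulVf ?gt_eqF// powRr1// ltW.
  have rn : r ^+ n.+1 = rho `^ gamma.
    by rewrite -powR_mulrn ?(ltW r0)// /r -powRrM mulrC.
  have g0 : 0 < rho `^ gamma by exact: powR_gt0.
  have := H r (rho `^ gamma / a) r0 (divr_gt0 g0 a0).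
  rewrite ra (_ : homdim n = n.+1 * 2)%N; last by rewrite /homdim mulnC addnC.
  rewrite exprM rn => /le_trans; apply.
  have ab : (b / (a * rho)) ^+ 2 <= 1.
    rewrite expr_le1// ?divr_ge0// ?mulr_ge0 ?(ltW a0) ?(ltW rho0)//.
    by rewrite ler_pdivrMr ?mul1r// mulr_gt0.
  rewrite (_ : _ + _ = (1 + T ^+ 2 * (b / (a * rho)) ^+ 2 + K) * a * rho `^ gamma).
    rewrite (ler_wpM2r (ltW g0))// (ler_wpM2r (ltW a0))//.
    by rewrite lerD2r lerD2l -[leRHS]mulr1 ler_wpM2l// exprn_ge0// ltW.
  by field; rewrite !gt_eqF.
have [bE|b_gt0] := eqVneq b 0.
  rewrite bE in claim *; rewrite powR0 ?mulr0; last by rewrite mulf_neq0// gt_eqF.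
  suff -> : i = 0 by rewrite expr0n.
  apply/eqP; rewrite eq_le i0 andbT leNgt; apply/negP => i_gt0.
  have La : 0 < L * a by rewrite mulr_gt0.
  (* For this [rho] the right-hand side of [claim] equals [i], giving [2 * i <= i]. *)
  have rho0 : 0 < (i / (L * a)) `^ gamma^-1 by rewrite powR_gt0// divr_gt0.
  have := claim _ rho0.
  rewrite -powRrM mulVf ?gt_eqF// powRr1 ?divr_ge0 ?(ltW La)//.
  rewrite mulrCA divff ?gt_eqF// mulr1 mulr_ge0 ?(ltW a0) ?(ltW rho0)//.
  by move=> /(_ isT); lra.
have {b_gt0 b0} b0 : 0 < b by rewrite lt_neqAle eq_sym b_gt0.
have ba0 : 0 < b / a by exact: divr_gt0.
have := claim _ ba0; rewrite mulrCA divff ?gt_eqF// mulr1 => /(_ (lexx _)).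
set u := (b / a) `^ gamma => iu.
have u0 : 0 < u by exact: powR_gt0.
have ag : 0 < a `^ gamma by exact: powR_gt0.
have bg : b `^ gamma = u * a `^ gamma.
  by rewrite -powRM ?(ltW ba0) ?(ltW a0)// divfK// gt_eqF.
have sqE c : 0 < c -> c `^ (2 * gamma) = (c `^ gamma) ^+ 2.
  by move=> c0; rewrite mulrC powRrM powR_mulrn// powR_ge0.
rewrite powRB; last by rewrite (gt_eqF a0) implybT.
rewrite powR_mulrn ?(ltW a0)// !sqE// bg.
rewrite (_ : _ * _ = (L * a * u) ^+ 2); last by field; rewrite gt_eqF.
apply: lerXn2r; rewrite ?nnegrE// ?mulr_ge0 ?(ltW L0) ?(ltW a0) ?(ltW u0)//.
by rewrite (le_trans _ iu)//; lra.
Qed.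

Lemma L1_interpolation : exists2 L : R, 0 < L &
  forall f : heis R n -> R[i], CLfun (haar R n) 2 f ->
  (CLnorm (haar R n) 1 f ^+ 2 <= L%:E *
   CLnorm (haar R n) 2 f `^ (2 - (homdim n)%:R / alpha)%R *
   CLnorm (haar R n) 2 (fun p => (koranyi p `^ alpha)%:C * f p)%R
     `^ ((homdim n)%:R / alpha)%R)%E.
Proof.
have L0 : 0 < (1 + T ^+ 2 + K) ^+ 2 by rewrite exprn_gt0// !addr_gt0// exprn_gt0.
exists ((1 + T ^+ 2 + K) ^+ 2) => // f [mf fA]; rewrite Qalpha.
set B := CLnorm _ _ (fun p => (koranyi p `^ alpha)%:C * f p).
set A := CLnorm _ 2 f in fA *.
pose g p := Normc.normc (f p).
have g0 p : 0 <= g p by exact: normc_ge0.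
have mg : measurable_fun setT g by exact: (measurableT_comp (@measurable_normc R)).
have k0 p : 0 <= koranyi p `^ alpha * g p by rewrite mulr_ge0 ?powR_ge0.
have N2 (h : heis R n -> R) : (forall p, 0 <= h p) ->
    ('N[haar R n]_2%:E[EFin \o h] `^ 2 = \int[haar R n]_p (h p ^+ 2)%:E)%E.
  move=> h0; rewrite poweR_Lnorm//; apply: eq_integral => p _ /=.
  by rewrite ger0_norm// powR_mulrn.
have A2 : (A `^ 2 = \int[haar R n]_p (g p ^+ 2)%:E)%E by exact: N2.
have BE : B = 'N[haar R n]_2%:E[EFin \o (fun p => koranyi p `^ alpha * g p)%R]%E.
  rewrite /B /CLnorm; apply: eq_Lnorm => p /=.
  by rewrite Normc.normcM normc_real ger0_norm ?powR_ge0.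
have B2 : (B `^ 2 = \int[haar R n]_p ((koranyi p `^ alpha * g p) ^+ 2)%:E)%E.
  by rewrite BE; exact: N2.
have -> : CLnorm (haar R n) 1 f = (\int[haar R n]_p (g p)%:E)%E.
  rewrite /CLnorm Lnorm1; apply: eq_integral => p _ /=.
  by rewrite ger0_norm// normc_ge0.
set I := (\int[_]_p _)%E.
have I0 : (0 <= I)%E by apply: integral_ge0 => p _; rewrite lee_fin.
have A0 : (0 <= A)%E by exact: Lnorm_ge0.
have B0 : (0 <= B)%E by exact: Lnorm_ge0.
have D r s r0 s0 := @dyadic_integral g r s r0 s0 mg g0.
rewrite -A2 -B2 -/I in D.
(* Here [f] vanishes almost everywhere, so the left side is 0 whatever the weighted norm is. *)
have [Az|An0] := eqVneq A 0%E.
  have -> : I = 0%E.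
    rewrite /I -[RHS](integral0 (haar R n) setT).
    apply: ge0_ae_eq_integral => //.
    - exact/measurable_EFinP.
    - by move=> p _; rewrite lee_fin.
    - apply: Lnorm_eq0_eq0 Az => //; exact/measurable_EFinP.
  by rewrite expe2 mule0 !mule_ge0 ?poweR_ge0// lee_fin ltW.
have {}A0 : (0 < A)%E by rewrite lt_neqAle eq_sym An0.
move: B B0 {BE B2} D => [b| |//] B0 D; last first.
  have g2 : 2 * gamma != 0 by rewrite mulf_neq0// gt_eqF.
  rewrite (poweRyr g2) gt0_muley ?leey//.
  by rewrite mule_gt0 ?lte_fin// poweR_gt0.
move: A fA A0 {An0 A2} D => [a| |//] _ A0 D //.
rewrite !poweR_EFin -!EFinM.
(* Both norms are now finite, and the scales [r = s = 1] already show that [f] is integrable. *)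
have Ifin : I \is a fin_num.
  rewrite ge0_fin_numE//; have := D _ _ ltr01 ltr01.
  rewrite !poweR_EFin -!EFinM -!EFinD.
  by case: (I) => [x _| |//]; rewrite ?ltry// gt0_muley.
rewrite -(fineK Ifin) -EFin_expe lee_fin.
apply: optimize_scales => //; first exact: fine_ge0.
move=> r s r0 s0; have := D r s r0 s0.
rewrite -(fineK Ifin) !poweR_EFin -!EFinM -!EFinD lee_fin.
by rewrite !powR_mulrn// ltW.
Qed.

End interpolation.

(** * Pointwise bound on the transform *)

Section integral_bounds.
Context d (T : measurableType d) (R : realType).
Variable mu : {measure set T -> \bar R}.

(* [ge0_le_integral] without measurability: the integral of a nonnegative
   function is a supremum over the simple functions below it. *)
Lemma ge0_le_integral_sup (D : set T) (f g : T -> \bar R) :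
  (forall x, D x -> 0 <= f x)%E -> (forall x, D x -> f x <= g x)%E ->
  (\int[mu]_(x in D) f x <= \int[mu]_(x in D) g x)%E.
Proof.
move=> f0 fg; have fg' x : ((f \_ D) x <= (g \_ D) x)%E.
  by rewrite !patchE; case: ifPn => // /set_mem; exact: fg.
rewrite integral_mkcond [leRHS]integral_mkcond !ge0_integralTE.
- by apply: le_ereal_sup => _ [h hf <-]; exists h => // x; exact: le_trans (hf x) _.
- by apply: erestrict_ge0 => x Dx; exact: le_trans (f0 x Dx) (fg x Dx).
- exact: erestrict_ge0.
Qed.

(** The positive and negative parts both have integral in [[0, i]], so their difference lies in
    [[- i, i]]. No measurability of [F] is required, which spares proving it for the kernel of the
    transform. *)
Lemma norm_Rintegral_le (F G : T -> R) (i : R) :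
  (forall x, `|F x| <= G x) -> (\int[mu]_x (G x)%:E = i%:E)%E ->
  `|(\int[mu]_x F x)%R| <= i.
Proof.
move=> FG Gi; rewrite /Rintegral integralE.
have P0 x : (0 <= (EFin \o F) ^\+ x)%E by exact: funepos_ge0.
have N0 x : (0 <= (EFin \o F) ^\- x)%E by exact: funeneg_ge0.
have : (\int[mu]_x ((EFin \o F) ^\+ x) <= i%:E)%E.
  rewrite -Gi; apply: ge0_le_integral_sup => x _ //.
  rewrite funeposE -EFin_max lee_fin ge_max (le_trans (ler_norm _) (FG x)).
  exact: le_trans (FG x).
have : (\int[mu]_x ((EFin \o F) ^\- x) <= i%:E)%E.
  rewrite -Gi; apply: ge0_le_integral_sup => x _ //.
  rewrite funenegE -EFinN -EFin_max lee_fin ge_max (le_trans _ (FG x)) ?(le_trans _ (FG x))//.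
  by rewrite -normrN ler_norm.
have := integral_ge0 mu (fun x (_ : setT x) => P0 x).
have := integral_ge0 mu (fun x (_ : setT x) => N0 x).
case: (integral _ _ _) => [a| |]//; case: (integral _ _ _) => [b| |]//.
rewrite -EFinB/= !lee_fin => a0 b0 ai bi.
by rewrite ler_norml; apply/andP; split; lra.
Qed.

(** The factor 2 comes from estimating the real and imaginary parts separately. *)
Lemma normc_Cintegral_le (F : T -> R[i]) (G : T -> R) (i : R) :
  (forall x, Normc.normc (F x) <= G x) -> (\int[mu]_x (G x)%:E = i%:E)%E ->
  Normc.normc (Cintegral mu F) <= 2 * i.
Proof.
move=> FG Gi; rewrite (le_trans (normc_le _))//= mulr_natl mulr2n lerD//.
  by apply: norm_Rintegral_le Gi => x; exact: le_trans (Re_le_normc _) (FG x).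
by apply: norm_Rintegral_le Gi => x; exact: le_trans (Im_le_normc _) (FG x).
Qed.

End integral_bounds.

Section spherical_bound.
Variables (R : realType) (n : nat).

Lemma coef_bin k : coef R n k * 'C(k + n.-1, k)%:R = 1.
Proof.
have := bin_fact (leq_addr n.-1 k); rewrite addKn => binE.
by rewrite /coef mulrAC -natrM [(_ * 'C(_, _))%N]mulnC binE divff.
Qed.

Lemma coef_gt0 k : 0 < coef R n k.
Proof. by rewrite divr_gt0// ltr0n ?muln_gt0 !fact_gt0. Qed.

Lemma normc_spherical_le k l (p : heis R n) :
  Normc.normc (spherical_fun k l p) <= 'C(k + n.-1, k)%:R.
Proof.
rewrite Normc.normcM normc_real normcE/= cos2Dsin2 sqrtr1 mul1r.
rewrite /laguerre_fun normrM [X in _ * X]ger0_norm ?expR_ge0//.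
rewrite (_ : 4^-1 * `|l| * normCn p.1 ^+ 2 =
  2^-1 * `|l| * normCn p.1 ^+ 2 / 2); last by field.
by apply: laguerre_le; rewrite mulr_ge0 ?sqr_ge0// mulr_ge0.
Qed.

(** The normalization [coef R n k] cancels the binomial bound on the spherical function, so the
    estimate is uniform in [k], the frequency and [w]. *)
Lemma normc_sft_L1_le (f : heis R n -> R[i]) (i : R) aw : 0 <= i ->
  (\int[haar R n]_p (Normc.normc (f p))%:E)%E = i%:E ->
  measurable_fun setT f ->
  Normc.normc (sft_L1 f aw) <= 2 * i.
Proof.
move=> i0 fi mf; rewrite /sft_L1; case: ifPn => _; last first.
  (* Off the rays the transform is 0 by convention. *)
  by rewrite normcE/= expr0n addr0 sqrtr0 mulr_ge0.
set k := ray_index _ _; rewrite Normc.normcM normc_real gtr0_norm ?coef_gt0//.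
set c : R := 'C(k + n.-1, k)%:R.
rewrite (_ : 2 * i = coef R n k * (2 * (c * i))); last first.
  by rewrite [RHS]mulrCA [coef _ _ _ * _]mulrA coef_bin mul1r.
rewrite ler_pM2l ?coef_gt0//.
apply: (@normc_Cintegral_le _ _ _ _ _ (fun p => c * Normc.normc (f p))).
  move=> p; rewrite Normc.normcM mulrC ler_wpM2r ?normc_ge0//.
  exact: normc_spherical_le.
under eq_integral do rewrite EFinM.
rewrite ge0_integralZl_EFin ?fi//.
- by move=> p _; rewrite lee_fin normc_ge0.
- by apply/measurable_EFinP; exact: (measurableT_comp (@measurable_normc R)).
Qed.

End spherical_bound.

(** * The local uncertainty inequality *)

Theorem theorem5p3 (R : realType) (n : nat) (alpha : R) :
  (0 < n)%N -> (homdim n)%:R / 2 < alpha ->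
  exists2 C : R, 0 < C &
    forall (E : set ((Rm R * Rm R) * Cn R n)) (f : heis R n -> R[i]),
      measurable E -> E `<=` fan R n `*` setT ->
      CLfun (haar R n) 2 f ->
      (\int[nu2dw R n]_(p in E) (Normc.normc (sft f p) ^+ 2)%:E <=
       C%:E * nu2dw R n E *
       CLnorm (haar R n) 2 f `^ (2 - (homdim n)%:R / alpha)%R *
       CLnorm (haar R n) 2 (fun p => (koranyi p `^ alpha)%:C * f p)%R
         `^ ((homdim n)%:R / alpha)%R)%E.
Proof.
move=> _ alphaQ.
have [L L0 HL] := L1_interpolation alphaQ.
(* 4 is the square of the factor 2 in [normc_sft_L1_le]; [L] is the interpolation constant. *)
exists (4 * L) => [|E f mE _ f2]; first by rewrite mulr_gt0.
have := HL f f2; set A := (_ `^ (_ - _))%E; set B := (_ `^ (_ / _))%E.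
have -> : ((4 * L)%:E * nu2dw R n E * A * B = 4%:E * (L%:E * A * B) * nu2dw R n E)%E.
  by rewrite EFinM !muleA [X in (X * B)%E]muleAC [LHS]muleAC.
set M := (L%:E * A * B)%E => HM.
(* The bound [c] is an extended real so that [+oo] can be used when [f] is not integrable. *)
have intc c : (forall p, E p -> (Normc.normc (sft f p) ^+ 2)%:E <= c)%E ->
    (c <= 4%:E * M)%E ->
    (\int[nu2dw R n]_(p in E) (Normc.normc (sft f p) ^+ 2)%:E <=
     4%:E * M * nu2dw R n E)%E.
  move=> Hc cM; apply: (@le_trans _ _ (c * nu2dw R n E)%E).
    rewrite -integral_cst//; apply: ge0_le_integral_sup => // p _.
    by rewrite lee_fin sqr_ge0.
  exact: lee_wpmul2r.
have CN1 : CLnorm (haar R n) 1 f = (\int[haar R n]_p (Normc.normc (f p))%:E)%E.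
  rewrite /CLnorm Lnorm1; apply: eq_integral => p _ /=.
  by rewrite ger0_norm// normc_ge0.
(* If [f] is not integrable, interpolation forces [M = +oo]. The bound [c = +oo] then also covers a
   null [E], where both sides are 0. *)
have [f1|nf1] := pselect (CLfun (haar R n) 1 f); last first.
  have N1 : CLnorm (haar R n) 1 f = +oo%E.
    apply/eqP; rewrite -leye_eq leNgt; apply/negP => f1.
    by apply: nf1; split => //; case: f2.
  apply: (intc +oo%E) => [p _|]; first exact: leey.
  by move: HM; rewrite N1 expe2 mulyy leye_eq => /eqP ->; rewrite gt0_muley.
have [mf f1oo] := f1.
have N1fin : CLnorm (haar R n) 1 f \is a fin_num.
  by rewrite ge0_fin_numE// Lnorm_ge0.
set i := fine (CLnorm (haar R n) 1 f).
have iE : CLnorm (haar R n) 1 f = i%:E by rewrite fineK.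
have i0 : 0 <= i by apply: fine_ge0; exact: Lnorm_ge0.
apply: (intc (4 * i ^+ 2)%:E) => [p _|].
  rewrite lee_fin (_ : 4 * i ^+ 2 = (2 * i) ^+ 2); last by ring.
  apply: lerXn2r; rewrite ?nnegrE ?normc_ge0 ?mulr_ge0//.
  by rewrite /sft mem_set//; apply: normc_sft_L1_le => //; rewrite -CN1.
by rewrite EFinM lee_pmul2l// EFin_expe -iE.
Qed.
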